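(* Fix $\alpha\in(0,1)$ and consider known variance ($r=\infty$, $\hat\sigma=\sigma=1$). Consider predictor matrices $X$ with $\operatorname{rank}(X)=d$ and model universes $\mathcal M$ that contain at least one maximal nested sequence of submodels. Then the infimum of $K(X,\mathcal M,\alpha)$ over all such $X$ and $\mathcal M$ is attained for orthogonal designs with $d$ columns, and, as $d\to\infty$, $$\inf_{\operatorname{rank}(X)=d}K(X,\mathcal M,\alpha)=K_{\mathrm{orth}}(d,\alpha)=\sqrt{2\log d}\,(1+o(1)).$$
   Context: Let $X=(X_1,\dots,X_p)$ be a real $d\times p$ matrix of rank $d$ (a predictor matrix of rank $d$ in canonical coordinates, i.e. expressed in an orthonormal basis of its column space; $p\ge d$ arbitrary). $\mathcal M_{\mathrm{all}}$ is the set of nonempty $M\subset\{1,\dots,p\}$ such that the columns $\{X_j:j\in M\}$ are linearly independent. A model universe is a nonempty $\mathcal M\subset\mathcal M_{\mathrm{all}}$ with $\bigcup_{M\in\mathcal M}M=\{1,\dots,p\}$. A maximal nested sequence of submodels is a sequence $\{j_1\},\{j_1,j_2\},\dots,\{j_1,\dots,j_d\}$ with distinct $j_1,\dots,j_d$. For $M\in\mathcal M_{\mathrm{all}}$, $j\in M$, $X_{j\cdot M}$ is the residual vector of $X_j$ after orthogonal projection onto the span of $\{X_k:k\in M\setminus\{j\}\}$, and $\bar l_{j\cdot M}=X_{j\cdot M}/\|X_{j\cdot M}\|$. With $Z\sim N(0,I_d)$, $K(X,\mathcal M,\alpha)$ is the minimal $K$ with $P[\max_{M\in\mathcal M}\max_{j\in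 M}|\bar l_{j\cdot M}^TZ|\le K]\ge1-\alpha$. An orthogonal design with $d$ columns is a $d\times d$ matrix with nonzero pairwise orthogonal columns; its constant $K(X,\mathcal M,\alpha)$ does not depend on $X$ or $\mathcal M$ and is denoted $K_{\mathrm{orth}}(d,\alpha)$. *)

(* Defs.v *)
From HB Require Import structures.
From mathcomp Require Import all_boot all_order all_algebra.
From mathcomp Require Import all_classical all_reals all_analysis.
Import Order.TTheory GRing.Theory Num.Theory.
Import numFieldNormedType.Exports.

Set Implicit Arguments.
Unset Strict Implicit.
Unset Printing Implicit Defensive.

Local Open Scope classical_set_scope.
Local Open Scope ring_scope.

Definition cons_pair (R : realType) (n : nat)
    (x : measurableTypeR R * n.-tuple (measurableTypeR R)) :
  n.+1.-tuple (measurableTypeR R) := [tuple of x.1 :: x.2].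

Lemma measurable_cons_pair (R : realType) (n : nat) :
  measurable_fun [set: measurableTypeR R * n.-tuple (measurableTypeR R)]
    (@cons_pair R n).
Proof. exact: measurable_cons measurable_fst measurable_snd. Qed.

HB.instance Definition _ (R : realType) (n : nat) :=
  isMeasurableFun.Build _ _ _ _ (@cons_pair R n) (@measurable_cons_pair R n).

Definition prod_prob (d1 d2 : measure_display) (T1 : measurableType d1)
    (T2 : measurableType d2) (R : realType)
    (P : probability T1 R) (Q : probability T2 R) : set (T1 * T2) -> \bar R :=
  (P \x Q)%E.

HB.instance Definition _ (d1 d2 : measure_display) (T1 : measurableType d1)
    (T2 : measurableType d2) (R : realType)
    (P : probability T1 R) (Q : probability T2 R) :=
  Measure.on (prod_prob P Q).

Lemma prod_prob_setT (d1 d2 : measure_display) (T1 : measurableType d1)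
    (T2 : measurableType d2) (R : realType)
    (P : probability T1 R) (Q : probability T2 R) :
  prod_prob P Q [set: T1 * T2] = 1%E.
Proof.
transitivity (P [set: T1] * Q [set: T2])%E.
  by rewrite -setXTT; exact: product_measure1E.
by rewrite !probability_setT mule1.
Qed.

HB.instance Definition _ (d1 d2 : measure_display) (T1 : measurableType d1)
    (T2 : measurableType d2) (R : realType)
    (P : probability T1 R) (Q : probability T2 R) :=
  Measure_isProbability.Build _ _ _ (prod_prob P Q) (prod_prob_setT P Q).

(** N(0, I_n): the n-fold product of the law N(0, 1), built coordinate by
    coordinate. *)
Fixpoint std_gaussian (R : realType) (n : nat) :
    probability (n.-tuple (measurableTypeR R)) R :=
  if n is n'.+1
  then distribution (prod_prob (normal_prob 0 1) (std_gaussian R n'))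
                    (@cons_pair R n')
  else \d_[tuple].

Lemma std_gaussianX (R : realType) (n : nat) (A : 'I_n -> set (measurableTypeR R)) :
  (forall i, measurable (A i)) ->
  std_gaussian R n [set z | forall i, A i (tnth z i)] =
  (\prod_(i < n) normal_prob 0 1 (A i))%E.
Proof.
elim: n A => [|n IHn] A mA.
  rewrite big_ord0 /= diracE mem_set//=; by case.
rewrite big_ord_recl /= /distribution /pushforward.
rewrite [X in prod_prob _ _ X](_ : _ =
    A ord0 `*` [set z | forall i, A (lift ord0 i) (tnth z i)]); last first.
  apply/seteqP; split=> [[x z] /= xz|[x z] /= [x0 zi] i].
    by split=> [|i]; [exact: (xz ord0)|have := xz (lift ord0 i); rewrite tnthS].
  by case: (unliftP ord0 i) => [j ->|->//]; rewrite tnthS.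
have mB : measurable [set z : n.-tuple (measurableTypeR R) |
    forall i, A (lift ord0 i) (tnth z i)].
  rewrite (_ : mkset _ = \bigcap_(i in [set: 'I_n])
      ((@tnth n (measurableTypeR R))^~ i @^-1` A (lift ord0 i))); last first.
    by apply/seteqP; split=> z /= zA i; [move=> _|]; exact: zA.
  apply: fin_bigcap_measurable => // i _; rewrite -[X in measurable X]setTI.
  exact: measurable_tnth.
rewrite /prod_prob product_measure1E//; congr (_ * _)%E.
by apply: (IHn (fun i => A (lift ord0 i))).
Qed.

Definition M_all (R : realType) (d p : nat) (X : 'M[R]_(d, p)) :
    {set {set 'I_p}} :=
  [set M : {set 'I_p} |
    (M != finset.set0) && free [seq col j X | j in M]]%SET.

Definition model_universe (R : realType) (d p : nat) (X : 'M[R]_(d, p))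
    (U : {set {set 'I_p}}) : bool :=
  [&& U != finset.set0, U \subset M_all X & finset.cover U == [set: 'I_p]%SET].

(** The indices [j] are 0-based: the submodels are
    [{j 0}, {j 0, j 1}, ..., {j 0, ..., j (d-1)}]. *)
Definition has_maximal_nested_sequence (d p : nat) (U : {set {set 'I_p}}) :
    Prop :=
  exists2 j : 'I_d -> 'I_p, injective j &
    forall k : 'I_d, [set j i | i : 'I_d & (i <= k)%N]%SET \in U.

(** The row space of this matrix is the span of the columns [X_k], [k \in N];
    [mxalgebra] works with row vectors, hence the transpositions. *)
Definition col_span (R : realType) (d p : nat) (X : 'M[R]_(d, p))
    (N : {set 'I_p}) : 'M[R]_d :=
  (\sum_(k in N) <<(col k X)^T>>)%MS.

(** [kermx A^T] is the orthogonal complement of the row space of [A], so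
    [proj_mx A (kermx A^T)] is the orthogonal projection onto the latter. *)
Definition ortho_proj (R : realType) (d : nat) (A : 'M[R]_d) : 'M[R]_d :=
  proj_mx A (kermx A^T).

Definition adj_pred (R : realType) (d p : nat) (X : 'M[R]_(d, p))
    (M : {set 'I_p}) (j : 'I_p) : 'cV[R]_d :=
  col j X - ((col j X)^T *m ortho_proj (col_span X (M :\ j)%SET))^T.

(** The norm [`|v|] that MathComp-Analysis puts on matrices is the sup norm. *)
Definition l2norm (R : realType) (d : nat) (v : 'cV[R]_d) : R :=
  Num.sqrt (\sum_i v i 0 ^+ 2).

Definition lbar (R : realType) (d p : nat) (X : 'M[R]_(d, p))
    (M : {set 'I_p}) (j : 'I_p) : 'cV[R]_d :=
  (l2norm (adj_pred X M j))^-1 *: adj_pred X M j.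

(** The quantities compared are nonnegative, so starting the maxima at 0 does
    not change them. *)
Definition max_abs_t (R : realType) (d p : nat) (X : 'M[R]_(d, p))
    (U : {set {set 'I_p}}) (z : d.-tuple (measurableTypeR R)) : R :=
  \big[Num.max/0]_(M in U) \big[Num.max/0]_(j in M)
    `|\sum_i lbar X M j i 0 * (tnth z i : R)|.

(** For [0 < alpha < 1] this set is nonempty and bounded below by 0, and it
    contains its infimum because distribution functions are right-continuous:
    the infimum is the minimal such [K]. *)
Definition posi_const (R : realType) (d p : nat) (X : 'M[R]_(d, p))
    (U : {set {set 'I_p}}) (alpha : R) : R :=
  inf [set K : R |
    ((1 - alpha)%:E <=
     std_gaussian R d [set z | (max_abs_t X U z <= K)%R]%classic)%E]%classic.

Definition orthogonal_design (R : realType) (d : nat) (X : 'M[R]_d) : Prop :=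
  (forall j, col j X != 0) /\
  (forall j k, j != k -> (col j X)^T *m col k X = 0).

(** The common value of [posi_const] over the orthogonal designs with [d]
    columns and their model universes, taken at the identity design. *)
Definition K_orth (R : realType) (d : nat) (alpha : R) : R :=
  posi_const (1%:M : 'M[R]_d) (M_all (1%:M : 'M[R]_d)) alpha.

Definition admissible (R : realType) (d p : nat) (X : 'M[R]_(d, p))
    (U : {set {set 'I_p}}) : Prop :=
  [/\ \rank X = d, model_universe X U & has_maximal_nested_sequence d U].

Definition posi_values (R : realType) (d : nat) (alpha : R) : set R :=
  [set K : R | exists (p : nat) (X : 'M[R]_(d, p)) (U : {set {set 'I_p}}),
    admissible X U /\ K = posi_const X U alpha]%classic.

(* Main.v *)
From HB Require Import structures.
Require Import Defs.
From mathcomp Require Import all_boot all_order all_algebra.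
From mathcomp Require Import all_classical all_reals all_analysis.
From mathcomp Require Import measurable_realfun ring lra.

(** The comparison rests on Gram-Schmidt.  Let [{j_1}, ..., {j_1, ..., j_d}] be
    a maximal nested sequence contained in the universe.  The vector
    [lbar_{j_k . {j_1, ..., j_k}}] is the normalized residual of [X_{j_k}] on
    the span of the columns that precede it, so these [d] vectors form an
    orthonormal basis ([nested_lbar_orthonormal]).  The maximum over the whole
    universe dominates the maximum over this basis, whose coordinates of [Z] are
    again independent standard normal variables.  Hence
    [P (max <= K) <= P (forall i, |Z_i| <= K)] for every [K], which says that
    the constant is at least the one of the identity design
    ([posi_const_ge_box]).  For an orthogonal design all residuals are the
    columns themselves, whatever the submodel, and the covering condition makes
    every column occur; the inequality becomes an equality
    ([posi_const_orthogonal]).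

    The rotation invariance of [N(0, I_n)] that this uses is [preserves_act_mx].
    In the plane, a reflection is a product of shears and a sign change, which
    preserve Lebesgue measure by Fubini and translation invariance, and it fixes
    the density, which depends on [x ^ 2 + y ^ 2] only
    ([preserves_plane_reflection]).  In dimension [n], an orthogonal matrix is
    reduced to one that fixes the first basis vector by an orthogonal
    transformation of the last [n - 1] coordinates followed by a reflection of
    the first two, and induction on [n] applies.

    For the asymptotics, write [q] for the tail [P (|Z_1| > K)], so that
    [P (forall i, |Z_i| <= K) = (1 - q) ^ d], and [t] for [sqrt (2 log d)], so
    that [d = exp (t ^ 2 / 2)].  If [K = (1 + e) t], then [d q] is at most a
    constant times [exp (- e t ^ 2 / 2)] and [(1 - q) ^ d >= 1 - d q] exceeds
    [1 - alpha] for large [d] ([K_orth_upper]).  If [K = (1 - e) t], then [d q]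
    tends to infinity and [(1 - q) ^ d <= exp (- d q)] falls below [1 - alpha]
    ([K_orth_lower]). *)

Import Order.TTheory GRing.Theory Num.Theory.
Import numFieldNormedType.Exports.

Set Implicit Arguments.
Unset Strict Implicit.
Unset Printing Implicit Defensive.

Local Open Scope classical_set_scope.
Local Open Scope ring_scope.

(** * Measure-preserving maps and the normal law of the plane *)

Section Preserves.
Local Open Scope ereal_scope.
Context (R : realType).

Definition preserves d (T : measurableType d) (mu : set T -> \bar R)
    (f : T -> T) : Prop :=
  measurable_fun [set: T] f /\
  forall A, measurable A -> mu (f @^-1` A) = mu A.

Lemma preimage_measurable d d' (T : measurableType d) (T' : measurableType d')
    (f : T -> T') (A : set T') :
  measurable_fun [set: T] f -> measurable A -> measurable (f @^-1` A).
Proof. by move=> mf mA; rewrite -[_ @^-1` _]setTI; exact: mf. Qed.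

Lemma preserves_comp d (T : measurableType d) (mu : set T -> \bar R) f g :
  preserves mu f -> preserves mu g -> preserves mu (f \o g).
Proof.
move=> [mf Hf] [mg Hg]; split; first exact: measurableT_comp.
move=> A mA; rewrite comp_preimage Hg ?Hf//; exact: preimage_measurable.
Qed.

(** Invariance under a map of the second coordinate that may depend on the
    first: it holds section by section, and integrating the measures of the
    sections gives the claim. *)
Lemma preserves_fiberwise d1 d2 (T1 : measurableType d1)
    (T2 : measurableType d2) (m1 : {sigma_finite_measure set T1 -> \bar R})
    (m2 : {sigma_finite_measure set T2 -> \bar R}) (g : T1 -> T2 -> T2) :
  measurable_fun [set: T1 * T2] (fun u => g u.1 u.2) ->
  (forall x, preserves m2 (g x)) ->
  preserves (m1 \x m2) (fun u => (u.1, g u.1 u.2)).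
Proof.
move=> mg Hg; split; first exact: measurable_fun_pair.
move=> A mA; apply: eq_integral => x _ /=.
by rewrite -[RHS](Hg x).2//; exact: measurable_xsection.
Qed.

Lemma preserves_swap d (T : measurableType d)
    (m : {sigma_finite_measure set T -> \bar R}) :
  preserves (m \x m) (fun u => (u.2, u.1)).
Proof.
split; first exact: measurable_fun_pair.
move=> A mA; transitivity ((m \x^ m) A).
  exact: eq_integral.
by apply/esym/product_measure_unique => //= ? ? ? ?; rewrite product_measure2E.
Qed.

Lemma preserves_density d (T : measurableType d)
    (mu : {measure set T -> \bar R}) (phi : T -> T) (f : T -> \bar R) A :
  preserves mu phi -> measurable_fun [set: T] f -> (forall x, 0 <= f x) ->
  f \o phi = f -> measurable A ->
  \int[mu]_(x in phi @^-1` A) f x = \int[mu]_(x in A) f x.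
Proof.
move=> [mphi Hphi] mf f0 fphi mA.
pose mix := isMeasurableFun.Build _ _ _ _ _ mphi.
pose phi' : {mfun T >-> T} := HB.pack phi mix.
transitivity (\int[pushforward mu phi']_(x in A) f x).
  rewrite ge0_integral_pushforward//; first by rewrite -[in LHS]fphi.
  exact: measurable_funTS.
by apply: eq_measure_integral => //= B mB _; exact: Hphi.
Qed.

End Preserves.

Section Density.
Local Open Scope ereal_scope.
Context d (T : measurableType d) (R : realType).
Variables (mu : {measure set T -> \bar R}) (f : T -> R).
Hypotheses (mf : measurable_fun [set: T] f) (f0 : forall x, (0 <= f x)%R).

(** The two properties of [f] are arguments so that the measure structure can
    be attached to the applied constant. *)
Definition with_density (_ : measurable_fun [set: T] f)
  (_ : forall x, (0 <= f x)%R) : set T -> \bar R :=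
  fun A => \int[mu]_(x in A) (f x)%:E.

Local Notation nu := (with_density mf f0).

Let nu0 : nu set0 = 0. Proof. by rewrite /with_density integral_set0. Qed.

Let nu_ge0 A : 0 <= nu A.
Proof. by apply: integral_ge0 => x _; rewrite lee_fin. Qed.

Let nu_sigma_additive : semi_sigma_additive nu.
Proof.
move=> A mA tA mUA; rewrite /with_density ge0_integral_bigcup//.
- by apply: is_cvg_ereal_nneg_natsum_cond => n _ _; exact: nu_ge0.
- by apply/measurable_EFinP; exact: measurable_funTS.
- by move=> x _; rewrite lee_fin.
Qed.

HB.instance Definition _ :=
  isMeasure.Build _ _ _ nu nu0 nu_ge0 nu_sigma_additive.

End Density.

Section Plane.
Local Open Scope ereal_scope.
Context (R : realType).
Local Notation lam := (@lebesgue_measure R).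
Local Notation RR := (measurableTypeR R).
Local Notation N01 := (normal_prob (0 : R) 1).

Lemma preserves_lebesgue_add (c : R) : preserves lam (fun x : RR => (x + c)%R : RR).
Proof.
have mc : measurable_fun setT (fun x : RR => (x + c)%R : RR).
  by apply: measurable_funD.
split=> // A mA.
pose mix := isMeasurableFun.Build _ _ _ _ _ mc.
pose phi : {mfun RR >-> RR} := HB.pack (fun x : RR => (x + c)%R : RR) mix.
rewrite [RHS](@lebesgue_measure_unique _ (pushforward lam phi))//.
move=> _ [[a b]] _ <-; transitivity (lam `](a - c)%R, (b - c)%R]%classic).
  rewrite !lebesgue_measure_itv/= !lte_fin ltrD2r.
  by case: ifP => // _; rewrite -!EFinB; congr EFin; ring.
congr (lam _).
by apply/seteqP; split=> x /=; rewrite !in_itv/= ltrBlDr lerBrDr.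
Qed.

Lemma preserves_lebesgue_opp : preserves lam (fun x : RR => (- x)%R : RR).
Proof.
split; first exact: oppr_measurable.
by move=> A mA; have := lebesgue_measureN mA.
Qed.

(** Along each vertical line a shear is a translation. *)
Lemma preserves_shear2 (t : R) :
  preserves (lam \x lam) (fun u : RR * RR => (u.1, (u.2 + t * u.1)%R : RR)).
Proof.
apply: (@preserves_fiberwise R _ _ _ _ lam lam (fun x y => (y + t * x)%R : RR)).
  by apply: measurable_funD => //; apply: measurable_funM.
by move=> x; exact: preserves_lebesgue_add.
Qed.

Lemma preserves_shear1 (t : R) :
  preserves (lam \x lam) (fun u : RR * RR => ((u.1 + t * u.2)%R : RR, u.2)).
Proof.
have sw := preserves_swap lam.
exact: (preserves_comp sw (preserves_comp (preserves_shear2 t) sw)).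
Qed.

Lemma preserves_flip2 :
  preserves (lam \x lam) (fun u : RR * RR => (u.1, (- u.2)%R : RR)).
Proof.
apply: (@preserves_fiberwise R _ _ _ _ lam lam (fun x y => (- y)%R : RR)).
  by apply: measurableT_comp.
by move=> x; exact: preserves_lebesgue_opp.
Qed.

(** For [a ^ 2 + b ^ 2 = 1], the reflection of the plane that exchanges the
    unit vector [(a, b)] and [(1, 0)]. *)
Definition plane_reflection (a b : R) (u : RR * RR) : RR * RR :=
  ((a * u.1 + b * u.2)%R, (b * u.1 - a * u.2)%R).

(** The reflection is the sign change of [y] followed by a rotation, and the
    rotation of angle [u] is the product of three shears with parameters [-
    tan (u / 2)], [sin u], [- tan (u / 2)]. The half-angle tangent [b / (a +
    1)] does not exist when [a = -1]. *)
Lemma preserves_plane_reflection_lebesgue (a b : R) : (a ^+ 2 + b ^+ 2 = 1)%R ->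
  preserves (lam \x lam) (plane_reflection a b).
Proof.
move=> ab1; have [aN1|aN1] := eqVneq a (-1)%R.
  have b0 : b = 0%R.
    move: ab1; rewrite aN1 sqrrN expr1n => /(canRL (addKr _)).
    by rewrite addNr => /eqP; rewrite sqrf_eq0 => /eqP.
  have sw := preserves_swap lam.
  have := preserves_comp sw (preserves_comp preserves_flip2 sw).
  congr preserves; apply/funext => -[x y]; rewrite /plane_reflection /= aN1 b0.
  by congr pair; ring.
have a1 : (a + 1 != 0)%R by rewrite addr_eq0.
(* [- tan (u / 2)], where [a = cos u] and [b = sin u]. *)
pose t := (- b / (a + 1))%R.
have := preserves_comp (preserves_shear1 t) (preserves_comp
  (preserves_shear2 b) (preserves_comp (preserves_shear1 t) preserves_flip2)).
congr preserves; apply/funext => -[x y]; rewrite /plane_reflection /= /t.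
have b2 : (b ^+ 2 = (1 - a) * (a + 1))%R.
  by rewrite -(addrK (a ^+ 2)%R (b ^+ 2)%R) [(b ^+ 2 + _)%R]addrC ab1; ring.
have e1 : (b * (- b / (a + 1)) = a - 1)%R.
  rewrite mulrA mulrN -expr2 b2 -mulNr -mulrA mulfV// ; ring.
have e2 : (1 + b * (- b / (a + 1)) = a)%R by rewrite e1; ring.
congr pair.
  set t' := (- b / (a + 1))%R in e1 e2 *.
  transitivity ((1 + b * t') * x - (t' * (1 + (1 + b * t'))) * y)%R; first ring.
  rewrite e2; congr (_ + _)%R; rewrite -mulNr; congr (_ * _)%R.
  by rewrite /t'; field.
set t' := (- b / (a + 1))%R in e1 e2 *.
transitivity (b * x - (1 + b * t') * y)%R; first ring.
by rewrite e2.
Qed.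

(** Both sides are measures in [A] that agree on rectangles. *)
Lemma N01_prodE (A : set (RR * RR)) : measurable A ->
  (N01 \x N01) A =
  \int[lam \x lam]_(u in A) (normal_pdf 0 1 u.1 * normal_pdf 0 1 u.2)%:E.
Proof.
move=> mA; pose f (u : RR * RR) : R := (normal_pdf 0 1 u.1 * normal_pdf 0 1 u.2)%R.
have mn := measurable_normal_pdf (0 : R) 1%R.
have mf : measurable_fun setT f.
  by apply: measurable_funM; apply: measurableT_comp.
have f0 u : (0 <= f u)%R by rewrite mulr_ge0// normal_pdf_ge0.
rewrite (@product_measure_unique _ _ _ _ _ N01 N01
  (with_density (lam \x lam) mf f0))//.
move=> B C mB mC; rewrite /= /with_density.
rewrite integral_mkcond fubini_tonelli1; last 2 first.
- apply/(measurable_restrictT _ _).1; first exact: measurableX.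
  by apply/measurable_EFinP; exact: measurable_funTS.
- by move=> u; apply: erestrict_ge0 => ? _; rewrite lee_fin.
rewrite /fubini_F /=.
transitivity (\int[lam]_x (((EFin \o normal_pdf 0 1) \_ B) x * N01 C)).
  apply: eq_integral => x _.
  have -> : N01 C = \int[lam]_x ((EFin \o normal_pdf 0 1) \_ C) x.
    by rewrite -integral_mkcond.
  rewrite -ge0_integralZl//.
  - apply: eq_integral => y _; rewrite !patchE in_setX/=.
    by case: (x \in B); case: (y \in C); rewrite ?mule0 ?mul0e.
  - apply/(measurable_restrictT _ _).1 => //.
    by apply/measurable_EFinP; exact: measurable_funTS.
  - by move=> y _; apply: erestrict_ge0 => ? _; rewrite lee_fin normal_pdf_ge0.
  - by apply: erestrict_ge0 => ? _; rewrite lee_fin normal_pdf_ge0.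
rewrite ge0_integralZr//.
- by rewrite -integral_mkcond.
- apply/(measurable_restrictT _ _).1 => //.
  by apply/measurable_EFinP; exact: measurable_funTS.
- by move=> y _; apply: erestrict_ge0 => ? _; rewrite lee_fin normal_pdf_ge0.
Qed.

Lemma normal_pdf01E (x : R) :
  normal_pdf 0 1 x = (normal_peak 1 * expR (- x ^+ 2 / 2))%R.
Proof. by rewrite normal_pdfE// /normal_fun subr0 expr1n. Qed.

Lemma preserves_N01_opp : preserves N01 (fun x : RR => (- x)%R : RR).
Proof.
split; first exact: oppr_measurable.
move=> A mA; apply: preserves_density => //.
- exact: preserves_lebesgue_opp.
- by apply/measurable_EFinP; exact: measurable_normal_pdf.
- by move=> x; rewrite lee_fin normal_pdf_ge0.
- by apply/funext => x /=; rewrite !normal_pdf01E sqrrN.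
Qed.

(** The joint density is a function of [x ^ 2 + y ^ 2]. *)
Lemma preserves_plane_reflection (a b : R) : (a ^+ 2 + b ^+ 2 = 1)%R ->
  preserves (N01 \x N01) (plane_reflection a b).
Proof.
move=> ab1; have [mr Hr] := preserves_plane_reflection_lebesgue ab1.
split=> // A mA; rewrite !N01_prodE//; last exact: preimage_measurable.
apply: preserves_density => //.
- apply/measurable_EFinP; apply: measurable_funM; apply: measurableT_comp => //;
  exact: measurable_normal_pdf.
- by move=> u; rewrite lee_fin mulr_ge0// normal_pdf_ge0.
apply/funext => -[x y] /=; congr EFin; rewrite !normal_pdf01E.
rewrite [LHS]mulrACA [RHS]mulrACA -!expRD; congr (_ * expR _)%R.
transitivity (- ((a ^+ 2 + b ^+ 2) * (x ^+ 2 + y ^+ 2)) / 2)%R; first ring.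
by rewrite ab1 mul1r; ring.
Qed.

End Plane.

(** * Rotation invariance of the standard Gaussian law *)

Section Rotation.
Context (R : realType).
Local Notation RR := (measurableTypeR R).
Local Notation N01 := (normal_prob (0 : R) 1).

Definition vec_of_tuple n (z : n.-tuple RR) : 'cV[R]_n := \col_i (tnth z i : R).

Definition tuple_of_vec n (v : 'cV[R]_n) : n.-tuple RR :=
  [tuple (v i 0 : RR) | i < n].

Definition act_mx n (Q : 'M[R]_n) (z : n.-tuple RR) : n.-tuple RR :=
  tuple_of_vec (Q *m vec_of_tuple z).

Lemma vec_of_tupleK n : cancel (@vec_of_tuple n) (@tuple_of_vec n).
Proof. by move=> z; apply: eq_from_tnth => i; rewrite tnth_mktuple mxE. Qed.

Lemma tuple_of_vecK n : cancel (@tuple_of_vec n) (@vec_of_tuple n).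
Proof. by move=> v; apply/colP => i; rewrite mxE tnth_mktuple. Qed.

Lemma act_mxM n (P Q : 'M[R]_n) : act_mx (P *m Q) = act_mx P \o act_mx Q.
Proof. by apply/funext => z; rewrite /act_mx /= tuple_of_vecK mulmxA. Qed.

Lemma tnth_act_mx n (Q : 'M[R]_n) z i :
  tnth (act_mx Q z) i = \sum_j Q i j * (tnth z j : R) :> R.
Proof.
by rewrite tnth_mktuple mxE; apply: eq_bigr => j _; rewrite mxE.
Qed.

Lemma measurable_act_mx n (Q : 'M[R]_n) :
  measurable_fun [set: n.-tuple RR] (act_mx Q).
Proof.
apply/measurable_fun_tnthP => i.
rewrite (_ : _ \o _ = fun z => \sum_j Q i j * (tnth z j : R)); last first.
  by apply/funext => z /=; rewrite tnth_act_mx.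
apply: measurable_sum => j; apply: measurable_funM => //.
exact: measurable_tnth.
Qed.

Lemma vec_of_tuple_cons n (x : RR) (z : n.-tuple RR) :
  vec_of_tuple [tuple of x :: z] = col_mx (x : R)%:M (vec_of_tuple z) :> 'cV_(1 + n).
Proof.
apply/colP => i; rewrite !mxE; case: splitP => j ij; rewrite !mxE.
  by rewrite ord1 (_ : i = ord0)//; apply/val_inj; rewrite /= ij ord1.
by rewrite (_ : i = lift ord0 j) ?tnthS//; apply/val_inj; rewrite /= ij.
Qed.

Lemma tuple_of_vec_cons n (x : R) (v : 'cV[R]_n) :
  tuple_of_vec (col_mx x%:M v : 'cV_(1 + n)) = [tuple of (x : RR) :: tuple_of_vec v].
Proof.
apply: (can_inj (@vec_of_tupleK n.+1)).
by rewrite tuple_of_vecK [RHS]vec_of_tuple_cons tuple_of_vecK.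
Qed.

Definition fix_first_mx n (Q : 'M[R]_n) : 'M[R]_(1 + n) := block_mx 1%:M 0 0 Q.

(** [plane_reflection a b] on the first two coordinates, the identity on the
    others. *)
Definition reflection_mx n (a b : R) : 'M[R]_(1 + (1 + n)) :=
  block_mx a%:M (row_mx b%:M 0) (col_mx b%:M 0) (block_mx (- a)%:M 0 0 1%:M).

Lemma reflection_mxE n a b (x y : R) (v : 'cV[R]_n) :
  reflection_mx n a b *m col_mx x%:M (col_mx y%:M v) =
  col_mx (a * x + b * y)%:M (col_mx (b * x - a * y)%:M v).
Proof.
rewrite /reflection_mx mul_block_col mul_row_col mul_col_mx mul_block_col.
rewrite !mul0mx !addr0 !mul1mx ?add0r add_col_mx -!scalar_mxM -!raddfD/=.
by rewrite add0r mulNr.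
Qed.

Lemma fix_first_mxE n (Q : 'M[R]_n) (x : 'cV[R]_1) (v : 'cV[R]_n) :
  fix_first_mx Q *m col_mx x v = col_mx x (Q *m v).
Proof. by rewrite mul_block_col !mul0mx mul1mx addr0 add0r. Qed.

Lemma tr_fix_first_mx n (Q : 'M[R]_n) : (fix_first_mx Q)^T = fix_first_mx Q^T.
Proof. by rewrite tr_block_mx !trmx0 trmx1. Qed.

Lemma fix_first_mxM n (P Q : 'M[R]_n) :
  fix_first_mx P *m fix_first_mx Q = fix_first_mx (P *m Q).
Proof.
by rewrite mulmx_block !mul0mx !mulmx0 mul1mx !addr0 !add0r.
Qed.

Lemma tr_reflection_mx n a b : (reflection_mx n a b)^T = reflection_mx n a b.
Proof.
by rewrite tr_block_mx tr_row_mx tr_col_mx tr_block_mx !trmx0 !tr_scalar_mx.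
Qed.

Lemma reflection_mx_invol n a b : a ^+ 2 + b ^+ 2 = 1 ->
  reflection_mx n a b *m reflection_mx n a b = 1%:M.
Proof.
move=> ab1.
suff H (u : 'cV[R]_(1 + (1 + n))) :
    reflection_mx n a b *m (reflection_mx n a b *m u) = u.
  apply/matrixP => i j.
  have := H (delta_mx j 0) => /matrixP/(_ i 0).
  by rewrite mulmxA -colE !mxE eqxx andbT.
rewrite -[u]vsubmxK -[dsubmx u]vsubmxK.
rewrite [usubmx u]mx11_scalar [usubmx (dsubmx u)]mx11_scalar !reflection_mxE.
set x := _ 0 0; set y := _ 0 0.
congr (col_mx _%:M (col_mx _%:M _)).
  transitivity ((a ^+ 2 + b ^+ 2) * x); first ring.
  by rewrite ab1 mul1r.
transitivity ((a ^+ 2 + b ^+ 2) * y); first ring.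
by rewrite ab1 mul1r.
Qed.

(** Some reflection maps [(x, y)] to a nonnegative multiple [(r, 0)] of the
    first basis vector. At the origin any reflection will do. *)
Lemma exists_reflection (x y : R) : exists a b r : R,
  [/\ a ^+ 2 + b ^+ 2 = 1, 0 <= r, a * x + b * y = r & b * x - a * y = 0].
Proof.
have [/eqP|xy0] := eqVneq (x ^+ 2 + y ^+ 2) 0.
  rewrite paddr_eq0 ?sqr_ge0// !sqrf_eq0 => /andP[/eqP-> /eqP->].
  by exists 1, 0, 0; split; rewrite // ?expr1n ?expr0n /=; ring.
have r2 : Num.sqrt (x ^+ 2 + y ^+ 2) ^+ 2 = x ^+ 2 + y ^+ 2.
  by rewrite sqr_sqrtr// addr_ge0 ?sqr_ge0.
have r0 : 0 <= Num.sqrt (x ^+ 2 + y ^+ 2) by [].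
have rn0 : Num.sqrt (x ^+ 2 + y ^+ 2) != 0.
  by apply: contra_neq xy0 => r00; rewrite -r2 r00 expr0n.
move: (Num.sqrt _) r2 r0 rn0 => r r2 r0 rn0.
exists (x / r), (y / r), r; split=> //.
- by rewrite !expr_div_n -mulrDl -r2 divff// sqrf_eq0.
- transitivity ((x ^+ 2 + y ^+ 2) / r); first ring.
  by rewrite -r2 expr2 mulfK.
- by ring.
Qed.

(** By induction the last [n] coordinates of [u] are first reduced to a single
    one; a reflection of the first two coordinates then absorbs it. *)
Lemma exists_orthogonal n (u : 'cV[R]_(1 + n)) :
  exists (Q : 'M[R]_(1 + n)) (r : R),
    Q *m Q^T = 1%:M /\ Q *m u = col_mx r%:M 0.
Proof.
elim: n u => [|n IHn] u.
  exists 1%:M, (usubmx u 0 0); split; first by rewrite trmx1 mul1mx.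
  by rewrite mul1mx -[LHS]vsubmxK [dsubmx u]flatmx0 [usubmx u in LHS]mx11_scalar.
have [Q [s [Qo Qs]]] := IHn (dsubmx u).
have [a [b [r [ab1 _ e1 e2]]]] := exists_reflection (usubmx u 0 0) s.
exists (reflection_mx n a b *m fix_first_mx Q), r; split.
  rewrite trmx_mul mulmxA -(mulmxA (reflection_mx _ _ _)) tr_fix_first_mx.
  rewrite fix_first_mxM Qo.
  rewrite tr_reflection_mx (_ : fix_first_mx _ = 1%:M) ?mulmx1 ?reflection_mx_invol//.
  by rewrite [RHS]scalar_mx_block.
rewrite -[u in LHS]vsubmxK -mulmxA fix_first_mxE Qs.
rewrite [usubmx u]mx11_scalar reflection_mxE.
by rewrite e1 e2 raddf0 col_mx0.
Qed.

Lemma std_gaussianS n (A : set (n.+1.-tuple RR)) :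
  std_gaussian R n.+1 A = (N01 \x std_gaussian R n)%E (@cons_pair R n @^-1` A).
Proof. by []. Qed.

Lemma preserves_fst d1 d2 (T1 : measurableType d1)
    (T2 : measurableType d2) (m1 : {measure set T1 -> \bar R})
    (m2 : {sigma_finite_measure set T2 -> \bar R}) (f : T1 -> T1) :
  preserves m1 f -> preserves (m1 \x m2)%E (fun u => (f u.1, u.2)).
Proof.
move=> [mf Hf]; split.
  by apply: measurable_fun_pair => //; exact: measurableT_comp.
move=> A mA.
pose mix := isMeasurableFun.Build _ _ _ _ _ mf.
pose phi : {mfun T1 >-> T1} := HB.pack f mix.
transitivity (\int[pushforward m1 phi]_x (m2 (xsection A x)))%E.
  rewrite ge0_integral_pushforward// ?preimage_setT//.
  exact: measurable_fun_xsection.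
by apply: eq_measure_integral => //= B mB _; exact: Hf.
Qed.

Lemma preserves_fix_first_mx n (Q : 'M[R]_n) :
  preserves (std_gaussian R n) (act_mx Q) ->
  preserves (std_gaussian R n.+1) (act_mx (fix_first_mx Q : 'M[R]_(n.+1))).
Proof.
move=> HQ; split; first exact: measurable_act_mx.
move=> A mA; rewrite !std_gaussianS.
have [|_ H] := @preserves_fiberwise R _ _ _ _ N01 (std_gaussian R n)
    (fun _ => act_mx Q) _ (fun=> HQ).
  by apply: measurableT_comp => //; exact: measurable_act_mx.
rewrite -[RHS]H; last first.
  by apply: preimage_measurable => //; exact: measurable_cons_pair.
congr (_ _); apply/seteqP; rewrite /preimage /=.
have E x (z : n.-tuple RR) :
    act_mx (fix_first_mx Q : 'M[R]_(n.+1)) (cons_pair (x, z)) =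
    cons_pair (x, act_mx Q z).
  by rewrite /act_mx /cons_pair vec_of_tuple_cons fix_first_mxE tuple_of_vec_cons.
by split=> -[x z] /=; rewrite E.
Qed.

(** The law of dimension [n + 2] is the product of [N(0, 1) x N(0, 1)] and the
    law of dimension [n], after reassociation of the coordinates; the
    reflection moves the planar factor only. *)
Lemma preserves_reflection_mx n (a b : R) : a ^+ 2 + b ^+ 2 = 1 ->
  preserves (std_gaussian R n.+2) (act_mx (reflection_mx n a b : 'M[R]_(n.+2))).
Proof.
move=> ab1; split; first exact: measurable_act_mx.
pose ass (u : RR * RR * n.-tuple RR) : n.+2.-tuple RR :=
  cons_pair (u.1.1, cons_pair (u.1.2, u.2)).
have mass : measurable_fun setT ass.
  apply: measurableT_comp; first exact: measurable_cons_pair.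
  apply: measurable_fun_pair; first exact: measurableT_comp.
  apply: measurableT_comp; first exact: measurable_cons_pair.
  by apply: measurable_fun_pair => //; exact: measurableT_comp.
have gE A : measurable A ->
    std_gaussian R n.+2 A = ((N01 \x N01) \x std_gaussian R n)%E (ass @^-1` A).
  move=> mA.
  have mB := preimage_measurable mass mA.
  (* Tonelli on the plane, with the law of the last [n] coordinates inside. *)
  pose g u := std_gaussian R n (xsection (ass @^-1` A) u).
  have mg : measurable_fun setT g by exact: measurable_fun_xsection.
  transitivity (\int[N01]_x fubini_F N01 g x)%E.
    rewrite std_gaussianS; apply: eq_integral => x _.
    apply: eq_integral => y _; congr (std_gaussian R n _).
    by apply/seteqP; split=> z; rewrite /xsection /= !inE /= !inE.
  have FT : (\int[N01 \x N01]_u g u = \int[N01]_x fubini_F N01 g x)%E.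
    by apply: fubini_tonelli1.
  by rewrite -FT.
move=> A mA; rewrite !gE//; last first.
  by apply: preimage_measurable => //; exact: measurable_act_mx.
have [_ H] : preserves ((N01 \x N01) \x std_gaussian R n)%E
    (fun u => (plane_reflection a b u.1, u.2)).
  exact: preserves_fst (preserves_plane_reflection ab1).
rewrite -[RHS]H; last exact: preimage_measurable.
congr (_ _); apply/seteqP; rewrite /preimage /=.
have E x y (z : n.-tuple RR) :
    act_mx (reflection_mx n a b : 'M[R]_(n.+2)) (ass ((x, y), z)) =
    ass (plane_reflection a b (x, y), z).
  rewrite /act_mx /ass /cons_pair /= !vec_of_tuple_cons reflection_mxE.
  by rewrite !tuple_of_vec_cons vec_of_tupleK.
by split=> -[[x y] z] /=; rewrite E.
Qed.

(** A 1 x 1 orthogonal matrix is a sign, and the normal law is symmetric. *)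
Lemma preserves_act_mx_dim1 (Q : 'M[R]_1) : Q *m Q^T = 1%:M ->
  preserves (std_gaussian R 1) (act_mx Q).
Proof.
rewrite [Q]mx11_scalar tr_scalar_mx -scalar_mxM.
move=> /matrixP/(_ 0 0); rewrite !mxE eqxx mulr1n -expr2 => /eqP.
set q := Q 0 0 => q1.
split; first exact: measurable_act_mx.
have Hq : preserves N01 (fun x : RR => (q * x : R) : RR).
  move: q1; rewrite sqrf_eq1 => /orP[] /eqP->.
    have -> : (fun x : RR => 1 * (x : R) : RR) = id.
      by apply/funext => x; rewrite mul1r.
    by split.
  have -> : (fun x : RR => -1 * (x : R) : RR) = (fun x : RR => - (x : R) : RR).
    by apply/funext => x; rewrite mulN1r.
  exact: preserves_N01_opp.
move=> A mA; rewrite !std_gaussianS.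
have [_ H] := @preserves_fst _ _ _ _ N01 (std_gaussian R 0) _ Hq.
rewrite -[RHS]H; last first.
  by apply: preimage_measurable => //; exact: measurable_cons_pair.
congr (_ _); apply/seteqP; rewrite /preimage /=.
have E x (z : 0.-tuple RR) :
    act_mx q%:M (cons_pair (x, z)) = cons_pair ((q * x : R) : RR, z).
  apply: eq_from_tnth => i; rewrite tnth_act_mx big_ord1 !ord1 mxE eqxx mulr1n.
  by [].
by split=> -[x z] /=; rewrite E.
Qed.

(** The columns of [Q] being orthonormal, once its first column has been
    mapped to the first basis vector, its first row vanishes off the diagonal,
    and what remains is an orthogonal matrix of smaller size. *)
Lemma preserves_act_mx n (Q : 'M[R]_n) : Q *m Q^T = 1%:M ->
  preserves (std_gaussian R n) (act_mx Q).
Proof.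
elim: n Q => [|[_|n IHn]] Q Qo; last 1 first.
- have [P [s [Po Ps]]] := exists_orthogonal (dsubmx (lsubmx (Q : 'M[R]_(1 + n.+1)))).
  have [a [b [r [ab1 r0 e1 e2]]]] :=
    exists_reflection (usubmx (lsubmx (Q : 'M[R]_(1 + n.+1))) 0 0) s.
  pose S : 'M[R]_(1 + n.+1) := reflection_mx n a b.
  pose G := fix_first_mx P.
  pose T : 'M[R]_(1 + n.+1) := S *m G *m Q.
  have SS : S *m S = 1%:M := reflection_mx_invol n ab1.
  have St : S^T = S := tr_reflection_mx n a b.
  have fix_first1 m : fix_first_mx (1%:M : 'M[R]_m) = 1%:M.
    by rewrite [RHS]scalar_mx_block.
  have GG : G *m G^T = 1%:M by rewrite tr_fix_first_mx fix_first_mxM Po fix_first1.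
  have QE : Q = G^T *m S *m T.
    rewrite /T !mulmxA -(mulmxA G^T) SS mulmx1 (mulmx1C GG) mul1mx//.
  have To : T *m T^T = 1%:M.
    rewrite /T !trmx_mul !mulmxA -(mulmxA (S *m G)) Qo mulmx1.
    by rewrite -(mulmxA S) GG mulmx1 St SS.
  have T1 : lsubmx T = col_mx r%:M 0.
    rewrite /T -mulmx_lsub -mulmxA -[lsubmx (Q : 'M[R]_(1 + n.+1))]vsubmxK.
    rewrite fix_first_mxE Ps.
    rewrite [usubmx (lsubmx (Q : 'M[R]_(1 + n.+1)))]mx11_scalar reflection_mxE e1 e2.
    by rewrite raddf0 col_mx0.
  (* The first column of [T] is [r e_0]; orthogonality then forces [r = 1] and
     kills the first row off the diagonal. *)
  have TE : T = block_mx r%:M (ursubmx T) 0 (drsubmx T).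
    rewrite -[LHS]submxK; congr block_mx.
      apply/matrixP => i j; have /matrixP/(_ (lshift _ i) j) := T1.
      by rewrite col_mxEu !mxE.
    apply/matrixP => i j; have /matrixP/(_ (rshift _ i) j) := T1.
    by rewrite col_mxEd !mxE.
  move: (mulmx1C To); rewrite TE tr_block_mx mulmx_block tr_scalar_mx trmx0.
  rewrite !mul0mx !mulmx0 !addr0 [1%:M](@scalar_mx_block _ 1).
  move=> /eq_block_mx[r1 ur _ _].
  have {r1} r1 : r = 1.
    move: r1; rewrite -scalar_mxM => /matrixP/(_ 0 0); rewrite !mxE eqxx !mulr1n.
    by rewrite -expr2 => /eqP; rewrite sqrp_eq1// => /eqP.
  have {}ur : ursubmx T = 0 by move: ur; rewrite r1 mul1mx.
  have TE' : T = fix_first_mx (drsubmx T) by rewrite [LHS]TE r1 ur.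
  have Ro : drsubmx T *m (drsubmx T)^T = 1%:M.
    move: To; rewrite TE' tr_fix_first_mx fix_first_mxM -fix_first1.
    move=> /eq_block_mx[_ _ _].
    by rewrite block_mxKdr.
  rewrite QE TE' tr_fix_first_mx !act_mxM.
  apply: preserves_comp; first apply: preserves_comp.
  + by apply: preserves_fix_first_mx; apply: IHn; rewrite trmxK; exact: mulmx1C.
  + exact: preserves_reflection_mx.
  + by apply: preserves_fix_first_mx; exact: IHn.
- have -> : act_mx Q = id by apply/funext => z; rewrite [LHS]tuple0 [RHS]tuple0.
  by split=> //; exact: measurable_id.
- exact: preserves_act_mx_dim1.
Qed.

End Rotation.

(** * Gram-Schmidt vectors and orthogonal designs *)

Section OrthoProj.
Context (R : realType).

Lemma mulmx_tr_eq0 n (u : 'rV[R]_n) : u *m u^T = 0 -> u = 0.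
Proof.
move=> /matrixP/(_ 0 0); rewrite !mxE => /eqP.
rewrite psumr_eq0; last by move=> i _; rewrite mxE -expr2 sqr_ge0.
move=> /allP u0; apply/rowP => i; rewrite !mxE.
by have := u0 i; rewrite mem_index_enum mxE -expr2 sqrf_eq0 => /(_ isT)/eqP.
Qed.

(** A vector that lies in the row space and is orthogonal to it is orthogonal
    to itself. *)
Lemma cap_orthocompl d (A : 'M[R]_d) : (A :&: kermx A^T)%MS = 0.
Proof.
apply/eqP/rowV0P => u; rewrite sub_capmx => /andP[/submxP[w uE] /sub_kermxP uA].
by apply: mulmx_tr_eq0; rewrite [in X in _ *m X]uE trmx_mul mulmxA uA mul0mx.
Qed.

Lemma add_orthocompl d m (A : 'M[R]_d) (v : 'M[R]_(m, d)) :
  (v <= A + kermx A^T)%MS.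
Proof.
apply: submx_full; rewrite /row_full mxrank_disjoint_sum ?cap_orthocompl//.
by rewrite mxrank_ker mxrank_tr subnKC ?rank_leq_row.
Qed.

Lemma ortho_proj_sub d (A : 'M[R]_d) (v : 'rV[R]_d) : (v *m ortho_proj A <= A)%MS.
Proof. exact: proj_mx_sub. Qed.

Lemma ortho_proj_resid d (A : 'M[R]_d) (v : 'rV[R]_d) :
  (v - v *m ortho_proj A) *m A^T = 0.
Proof.
apply/sub_kermxP.
have /(canRL (addKr _)) := add_proj_mx (cap_orthocompl A) (add_orthocompl A v).
by rewrite addrC => <-; exact: proj_mx_sub.
Qed.

Lemma ortho_proj0 d (A : 'M[R]_d) (v : 'rV[R]_d) :
  v *m A^T = 0 -> v *m ortho_proj A = 0.
Proof.
by move=> vA; apply: proj_mx_0; [exact: cap_orthocompl | exact/sub_kermxP].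
Qed.

Lemma col_spanP d p (X : 'M[R]_(d, p)) (N : {set 'I_p}) (v : 'cV[R]_d) :
  (v^T <= col_span X N)%MS ->
  exists a : 'I_p -> R, v = \sum_(k in N) a k *: col k X.
Proof.
move=> /sub_sumsmxP[w wE].
have H k : exists a, w k *m <<(col k X)^T>>%MS = a *: (col k X)^T.
  by apply/sub_rVP; rewrite (submx_trans (submxMl _ _))// genmxE.
have [a aE] := choice H; exists a.
apply: trmx_inj; rewrite wE linear_sum; apply: eq_bigr => k _.
by rewrite aE linearZ.
Qed.

Lemma col_sub_col_span d p (X : 'M[R]_(d, p)) (N : {set 'I_p}) k :
  k \in N -> ((col k X)^T <= col_span X N)%MS.
Proof. by move=> kN; rewrite /col_span (sumsmx_sup k)// genmxE. Qed.

Lemma adj_pred_ortho d p (X : 'M[R]_(d, p)) (M : {set 'I_p}) j k :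
  k \in (M :\ j)%SET -> (adj_pred X M j)^T *m col k X = 0.
Proof.
move=> kM; have /submxP[w wE] := col_sub_col_span X kM.
have E := ortho_proj_resid (col_span X (M :\ j)%SET) (col j X)^T.
rewrite -[col k X]trmxK wE trmx_mul mulmxA /adj_pred.
have trB (u w' : 'cV[R]_d) : (u - w')^T = u^T - w'^T.
  by apply/rowP => i; rewrite !mxE.
by rewrite trB trmxK E mul0mx.
Qed.

Lemma adj_pred_combination d p (X : 'M[R]_(d, p)) (M : {set 'I_p}) j :
  exists a : 'I_p -> R,
    adj_pred X M j = col j X - \sum_(k in (M :\ j)%SET) a k *: col k X.
Proof.
have [|a aE] := @col_spanP _ _ X (M :\ j)%SET
    ((col j X)^T *m ortho_proj (col_span X (M :\ j)%SET))^T.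
  by rewrite trmxK; exact: ortho_proj_sub.
by exists a; rewrite /adj_pred aE.
Qed.

(** If the residual vanished, [X_j] would be a combination of the other
    columns of [M], against linear independence. *)
Lemma adj_pred_neq0 d p (X : 'M[R]_(d, p)) (M : {set 'I_p}) j :
  M \in M_all X -> j \in M -> adj_pred X M j != 0.
Proof.
rewrite inE => /andP[_ fM] jM; apply/eqP.
have [a ->] := adj_pred_combination X M j; move=> /eqP; rewrite subr_eq0 => /eqP jE.
have pe : perm_eq (enum M) (j :: enum (M :\ j)%SET).
  apply: uniq_perm; rewrite /= ?enum_uniq ?mem_enum ?inE ?eqxx//= .
  by move=> k; rewrite in_cons !mem_enum !inE; case: eqVneq => [->|].
move: fM; rewrite /image_mem (perm_free (perm_map _ pe)) /= free_cons => /andP[+ _].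
apply/negP/negPn; rewrite [X in X \in _]jE; apply: rpred_sum => k kM.
by apply: rpredZ; apply: memv_span; apply/mapP; exists k; rewrite ?mem_enum.
Qed.

Lemma adj_pred_orthogonal_cols d p (X : 'M[R]_(d, p)) (M : {set 'I_p}) j :
  (forall k, k \in (M :\ j)%SET -> (col j X)^T *m col k X = 0) ->
  adj_pred X M j = col j X.
Proof.
move=> jM; rewrite /adj_pred ortho_proj0 ?trmx0 ?subr0//.
apply: trmx_inj; rewrite trmx0 trmx_mul !trmxK.
apply/row_matrixP => i; rewrite row0 row_mul.
have [|a aE] := @col_spanP _ _ X (M :\ j)%SET (row i (col_span X (M :\ j)%SET))^T.
  by rewrite trmxK; exact: row_sub.
apply: trmx_inj; rewrite trmx_mul aE trmx0 linear_sum /= big1// => k kM.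
by rewrite -scalemxAr jM ?scaler0.
Qed.

Lemma l2norm_sqr d (v : 'cV[R]_d) : v^T *m v = (l2norm v ^+ 2)%:M.
Proof.
rewrite [LHS]mx11_scalar; congr _%:M; rewrite !mxE sqr_sqrtr.
  by apply: eq_bigr => i _; rewrite mxE -expr2.
by apply: sumr_ge0 => i _; exact: sqr_ge0.
Qed.

Lemma l2norm_neq0 d (v : 'cV[R]_d) : v != 0 -> l2norm v != 0.
Proof.
apply: contra_neq => v0; apply: trmx_inj; rewrite trmx0; apply: mulmx_tr_eq0.
by rewrite trmxK l2norm_sqr v0 expr0n raddf0.
Qed.

Definition orthonormal_family d (q : 'I_d -> 'cV[R]_d) : Prop :=
  forall i j, (q i)^T *m q j = (i == j)%:R%:M.

Lemma normalize_orthonormal d (v : 'I_d -> 'cV[R]_d) :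
  (forall i, v i != 0) -> (forall i j : 'I_d, (i < j)%N -> (v j)^T *m v i = 0) ->
  orthonormal_family (fun i => (l2norm (v i))^-1 *: v i).
Proof.
move=> v0 vo i j; rewrite -[LHS]scalemxAr [(_ *: _)^T]linearZ/= -scalemxAl scalerA.
case: (ltngtP i j) => [ij|ji|/val_inj ->].
- rewrite (_ : _ *m _ = 0) ?scaler0.
    by rewrite -val_eqE /= (ltn_eqF ij) raddf0.
  by apply: trmx_inj; rewrite trmx_mul trmxK trmx0 vo.
- by rewrite vo// scaler0 -val_eqE /= (gtn_eqF ji) raddf0.
- rewrite l2norm_sqr scale_scalar_mx eqxx -expr2 -exprMn mulVf ?expr1n//.
  exact: l2norm_neq0.
Qed.

(** The residual of [X_{j_k}] is orthogonal to all earlier columns, and the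
    residual of an earlier column is a combination of these. *)
Lemma nested_lbar_orthonormal d p (X : 'M[R]_(d, p)) (j : 'I_d -> 'I_p) :
  injective j ->
  (forall k : 'I_d, [set j i | i : 'I_d & (i <= k)%N]%SET \in M_all X) ->
  orthonormal_family (fun k : 'I_d =>
    lbar X [set j i | i : 'I_d & (i <= k)%N]%SET (j k)).
Proof.
move=> jinj jM; apply: normalize_orthonormal.
  by move=> k; apply: adj_pred_neq0 => //; apply/imsetP; exists k; rewrite ?inE.
move=> i k ik.
have lk (l : 'I_d) : (l < k)%N ->
    j l \in ([set j i | i : 'I_d & (i <= k)%N] :\ j k)%SET.
  move=> lk; rewrite !inE (inj_eq jinj) -val_eqE /= (ltn_eqF lk) /=.
  by apply/imsetP; exists l; rewrite ?inE 1?ltnW.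
have [a ->] := adj_pred_combination X [set j l | l : 'I_d & (l <= i)%N]%SET (j i).
rewrite mulmxBr mulmx_sumr big1 ?subr0 ?adj_pred_ortho ?lk//.
move=> m; rewrite !inE => /andP[_ /imsetP[l]]; rewrite inE => li ->.
by rewrite -scalemxAr adj_pred_ortho ?scaler0// lk// (leq_ltn_trans li).
Qed.

Lemma orthogonal_lbar d (X : 'M[R]_d) (M : {set 'I_d}) j :
  orthogonal_design X -> lbar X M j = (l2norm (col j X))^-1 *: col j X.
Proof.
move=> [_ Xo]; rewrite /lbar adj_pred_orthogonal_cols// => k.
by rewrite !inE eq_sym => /andP[jk _]; exact: Xo.
Qed.

Lemma orthogonal_orthonormal d (X : 'M[R]_d) : orthogonal_design X ->
  orthonormal_family (fun j => (l2norm (col j X))^-1 *: col j X).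
Proof.
move=> [X0 Xo]; apply: normalize_orthonormal => // i j ij.
by apply: Xo; rewrite -val_eqE /= (gtn_eqF ij).
Qed.

(** Normalizing the columns gives a matrix with orthonormal columns, which
    exhibits a left inverse. *)
Lemma orthogonal_rank d (X : 'M[R]_d) : orthogonal_design X -> \rank X = d.
Proof.
move=> /orthogonal_orthonormal Xo; apply: mxrank_unit.
pose Y : 'M[R]_d := \matrix_(i, l) ((l2norm (col i X))^-1 *: col i X) l 0.
pose D : 'M[R]_d := diag_mx (\row_i (l2norm (col i X))^-1).
have : Y *m (X *m D) = 1%:M.
  apply/matrixP => i j; have /matrixP/(_ 0 0) := Xo i j.
  rewrite !mxE eqxx mulr1n => <-; apply: eq_bigr => l _.
  by rewrite mul_mx_diag !mxE; congr (_ * _); rewrite mulrC.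
by move=> /mulmx1_unit[_]; rewrite unitmx_mul => /andP[].
Qed.

(** A column lies outside the span of others because that span is inside the
    kernel of the scalar product with it, whereas its own square norm is not
    zero. *)
Lemma orthogonal_M_all d (X : 'M[R]_d) (M : {set 'I_d}) :
  orthogonal_design X -> M != finset.set0 -> M \in M_all X.
Proof.
move=> [X0 Xo] M0; rewrite inE M0 /image_mem /=.
elim: (enum M) (enum_uniq M) => [|j s IHs] /= ; first by rewrite nil_free.
move=> /andP[js us]; rewrite free_cons IHs// andbT.
pose f := linfun (mulmx (col j X)^T : 'cV[R]_d -> 'M[R]_1).
have fs : (<<[seq col k X | k <- s]>> <= lker f)%VS.
  apply/span_subvP => _ /mapP[k ks ->]; rewrite memv_ker lfunE/=.
  by rewrite Xo//; apply: contraNneq js => ->.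
apply/negP => /(subvP fs); rewrite memv_ker lfunE/= l2norm_sqr => /eqP.
move=> /matrixP/(_ 0 0); rewrite !mxE eqxx mulr1n => /eqP.
by rewrite sqrf_eq0; apply/negP/l2norm_neq0.
Qed.

Lemma orthogonal_admissible d (X : 'M[R]_d) : (0 < d)%N ->
  orthogonal_design X -> admissible X (M_all X).
Proof.
move=> d0 Xo; split; first exact: orthogonal_rank.
- have S1 j : [set j]%SET \in M_all X.
    by apply: orthogonal_M_all => //; apply/set0Pn; exists j; rewrite inE.
  apply/and3P; split=> //.
    by apply/set0Pn; exists [set Ordinal d0]%SET.
  apply/eqP/setP => j; rewrite inE; apply/bigcupP; exists [set j]%SET => //.
  by rewrite inE.
- exists id => // k; apply: orthogonal_M_all => //.
  by apply/set0Pn; exists k; apply/imsetP; exists k; rewrite ?inE.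
Qed.

Lemma identity_orthogonal d : orthogonal_design (1%:M : 'M[R]_d).
Proof.
have o i j : (col i 1%:M)^T *m col j (1%:M : 'M[R]_d) = (i == j)%:R%:M.
  rewrite tr_col trmx1 -row_mul mul1mx [LHS]mx11_scalar; congr _%:M.
  by rewrite !mxE.
split=> [j|j k jk]; last by rewrite o (negbTE jk) raddf0.
apply/eqP => c0; have /matrixP/(_ 0 0) := o j j.
by rewrite c0 mulmx0 !mxE !eqxx mulr1n => /eqP; rewrite eq_sym oner_eq0.
Qed.

End OrthoProj.

(** * Tails of the standard normal law *)

Section Tails.
Context (R : realType).
Local Notation RR := (measurableTypeR R).
Local Notation N01 := (normal_prob (0 : R) 1).
Local Notation lam := (@lebesgue_measure R).

Definition normal_tail (K : R) : R := fine (N01 (~` [set x : RR | `|x : R| <= K])).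

Lemma measurable_abs_le (K : R) : measurable [set x : RR | `|x : R| <= K].
Proof.
rewrite (_ : mkset _ = `[- K, K]%classic); first exact: measurable_itv.
by apply/seteqP; split=> x /=; rewrite in_itv/= ler_norml.
Qed.

Lemma normal_tailE K : N01 (~` [set x : RR | `|x : R| <= K]) = (normal_tail K)%:E.
Proof.
rewrite fineK// fin_num_measure//.
by apply: measurableC; exact: measurable_abs_le.
Qed.

Lemma normal_tail_ge0 K : 0 <= normal_tail K.
Proof. by rewrite fine_ge0. Qed.

Lemma normal_tail_le1 K : normal_tail K <= 1.
Proof.
rewrite -lee_fin -normal_tailE; apply: probability_le1.
by apply: measurableC; exact: measurable_abs_le.
Qed.

Lemma normal_abs_le K : N01 [set x : RR | `|x : R| <= K] = (1 - normal_tail K)%:E.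
Proof.
have := probability_setC N01 (measurableC (measurable_abs_le K)).
by rewrite setCK => ->; rewrite EFinB -normal_tailE.
Qed.

Lemma normal_peakM (s : R) : 0 < s -> normal_peak (1 : R) = s * normal_peak s.
Proof.
move=> s0; rewrite /normal_peak expr1n mul1r -mulrnAr sqrtrM ?sqr_ge0//.
by rewrite sqrtr_sqr gtr0_norm// invfM mulrA divff ?gt_eqF// mul1r.
Qed.

(** Exponential tilting: where [|x| > K], the standard normal density is at
    most [s exp (- (1 - s ^ -2) K ^ 2 / 2)] times the density of [N(0, s ^
    2)], and the latter has total mass 1. *)
Lemma normal_tail_ub (s K : R) : 1 <= s -> 0 <= K ->
  normal_tail K <= s * expR (- ((1 - (s ^+ 2)^-1) * K ^+ 2 / 2)).
Proof.
move=> s1 K0; have s0 : 0 < s by exact: lt_le_trans s1.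
rewrite -lee_fin -normal_tailE /normal_prob.
have mC : measurable (~` [set x : RR | `|x : R| <= K]).
  by apply: measurableC; exact: measurable_abs_le.
set c := s * _.
have c0 : 0 <= c by rewrite mulr_ge0 ?expR_ge0 ?ltW.
have mn m t : measurable_fun setT (EFin \o @normal_pdf R m t).
  by apply/measurable_EFinP; exact: measurable_normal_pdf.
apply: (@le_trans _ _ (\int[lam]_(x in ~` [set x : RR | (`|x : R| <= K)%R])
    (c%:E * (normal_pdf 0 s x)%:E))%E).
  apply: ge0_le_integral => //.
  - by move=> x _; rewrite lee_fin normal_pdf_ge0.
  - by apply: measurable_funTS; exact: mn.
  - by apply: measurable_funTS; apply: measurable_funeM; exact: mn.
  - move=> x /= /negP; rewrite -ltNge => Kx.
    rewrite -EFinM lee_fin normal_pdf01E normal_pdfE ?gt_eqF// (normal_peakM s0).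
    rewrite /c /normal_fun subr0.
    rewrite [leRHS]mulrACA ler_wpM2l ?mulr_ge0 ?normal_peak_ge0 ?(ltW s0)//.
    rewrite -expRD ler_expR.
    have x2 : K ^+ 2 <= x ^+ 2.
      by rewrite -(real_normK (num_real x)) ler_pXn2r ?nnegrE// ltW.
    have s2 : s ^+ 2 != 0 by rewrite sqrf_eq0 gt_eqF.
    have q0 : 0 <= 1 - (s ^+ 2)^-1.
      by rewrite subr_ge0 invf_le1 ?exprn_gt0// expr_ge1// ltW.
    rewrite -[s ^+ 2 *+ 2]mulr_natr (invfM (s ^+ 2)).
    move: (s ^+ 2)^-1 q0 => q q0.
    rewrite -subr_ge0.
    have -> : - x ^+ 2 * (q / 2) = - (q * x ^+ 2 / 2) by ring.
    have -> : - ((1 - q) * K ^+ 2 / 2) + - (q * x ^+ 2 / 2) - - x ^+ 2 / 2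
      = (1 - q) * (x ^+ 2 - K ^+ 2) / 2 by field.
    by rewrite mulr_ge0// mulr_ge0// subr_ge0.
rewrite ge0_integralZl//; last 2 first.
- by apply: measurable_funTS; exact: mn.
- by move=> x _; rewrite lee_fin normal_pdf_ge0.
rewrite -[leRHS]mule1 lee_pmul//; last exact: (@probability_le1 _ _ _ (normal_prob 0 s)).
by apply: integral_ge0 => x _; rewrite lee_fin normal_pdf_ge0.
Qed.

(** The density on the interval from [K] to [K + 1] is at least its value at
    [K + 1]. *)
Lemma normal_tail_lb (K : R) : 0 <= K ->
  normal_peak 1 * expR (- (K + 1) ^+ 2 / 2) <= normal_tail K.
Proof.
move=> K0; rewrite -lee_fin -normal_tailE.
have sub : `]K, (K + 1)]%classic `<=` ~` [set x : RR | `|x : R| <= K].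
  move=> x /=; rewrite in_itv/= => /andP[Kx _]; apply/negP; rewrite -ltNge.
  by rewrite (lt_le_trans Kx)// ler_norm.
apply: (@le_trans _ _ (N01 `]K, (K + 1)]%classic)); last first.
  apply: le_measure => //; rewrite inE; first exact: measurable_itv.
  by apply: measurableC; exact: measurable_abs_le.
rewrite /normal_prob; set c := _ * _.
have -> : c%:E = (\int[lam]_(x in `]K, (K + 1)%R]) c%:E)%E.
  rewrite integral_cst; last exact: measurable_itv.
  rewrite -[LHS]mule1; congr (_ * _)%E; apply/esym.
  transitivity (lam `]K, (K + 1)]%classic); first by [].
  by rewrite lebesgue_measure_itv/= lte_fin ltrDl ltr01 -EFinB addrAC subrr add0r.
apply: ge0_le_integral => //.
- by move=> x _; rewrite lee_fin mulr_ge0 ?normal_peak_ge0 ?expR_ge0.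
- by apply: measurable_funTS; apply/measurable_EFinP; exact: measurable_normal_pdf.
- move=> x; rewrite /= in_itv/= => /andP[Kx xK].
  rewrite lee_fin normal_pdf01E ler_wpM2l ?normal_peak_ge0// ler_expR.
  rewrite ler_pM2r// lerN2 ler_pXn2r ?nnegrE//; first by rewrite (le_trans K0)// ltW.
  by rewrite addr_ge0.
Qed.

End Tails.

(** * Comparison with the identity design, and asymptotics *)

Section Constants.
Context (R : realType).
Local Notation RR := (measurableTypeR R).

(** [max_abs_t] starts from 0, so its sublevel sets are empty for [K < 0],
    even if [d = 0]; hence the condition [0 <= K]. *)
Definition coord_box d (K : R) : set (d.-tuple RR) :=
  [set z | 0 <= K /\ forall i, `|tnth z i : R| <= K].
Arguments coord_box : clear implicits.

Lemma measurable_coord_box d K : measurable (coord_box d K).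
Proof.
have [K0|K0] := leP 0 K; last first.
  rewrite (_ : coord_box d K = set0)//.
  by apply/seteqP; split=> z //= -[]; rewrite leNgt K0.
rewrite (_ : coord_box d K = \bigcap_(i in [set: 'I_d])
    ((@tnth d RR)^~ i @^-1` [set x : RR | `|x : R| <= K])).
  apply: fin_bigcap_measurable => // i _.
  by apply: preimage_measurable; [exact: measurable_tnth|exact: measurable_abs_le].
apply/seteqP; split=> z /=; first by move=> [_ zK] i _; exact: zK.
by move=> zK; split=> // i; exact: zK.
Qed.

Lemma std_gaussian_coord_box d (K : R) : 0 <= K ->
  std_gaussian R d (coord_box d K) = ((1 - normal_tail K) ^+ d)%:E.
Proof.
move=> K0; pose B (i : 'I_d) := [set x : RR | `|x : R| <= K].
rewrite (_ : coord_box d K = [set z | forall i, B i (tnth z i)]); last first.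
  by apply/seteqP; split=> z /=; [case|].
rewrite std_gaussianX; last by move=> i; exact: measurable_abs_le.
rewrite (eq_bigr (fun=> (1 - normal_tail K)%:E)); last first.
  by move=> i _; exact: normal_abs_le.
by rewrite prodEFin prodr_const card_ord.
Qed.

(** The coordinates of [z] in an orthonormal basis are [Q z] with [Q]
    orthogonal, so the event is the preimage of a box under a map that
    preserves the law. *)
Lemma std_gaussian_orthonormal_box d (q : 'I_d -> 'cV[R]_d) (K : R) :
  orthonormal_family q ->
  measurable [set z : d.-tuple RR | 0 <= K /\
      forall k, `|\sum_i q k i 0 * (tnth z i : R)| <= K] /\
  std_gaussian R d [set z | 0 <= K /\
      forall k, `|\sum_i q k i 0 * (tnth z i : R)| <= K] =
  std_gaussian R d (coord_box d K).
Proof.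
move=> qo; pose Q : 'M[R]_d := \matrix_(k, i) q k i 0.
have QQ : Q *m Q^T = 1%:M.
  apply/matrixP => i j; have /matrixP/(_ 0 0) := qo i j.
  rewrite !mxE eqxx mulr1n => <-.
  by apply: eq_bigr => l _; rewrite !mxE.
have [mQ HQ] := preserves_act_mx QQ.
rewrite (_ : [set z | _] = act_mx Q @^-1` coord_box d K).
  split; first by apply: preimage_measurable => //; exact: measurable_coord_box.
  by rewrite HQ//; exact: measurable_coord_box.
have E z k : tnth (act_mx Q z) k = \sum_i q k i 0 * (tnth z i : R) :> R.
  by rewrite tnth_act_mx; apply: eq_bigr => i _; rewrite mxE.
by apply/seteqP; split=> z /= -[K0 zK]; split=> // k; move: (zK k); rewrite E.
Qed.

Lemma max_abs_tP d p (X : 'M[R]_(d, p)) U (z : d.-tuple RR) (K : R) :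
  max_abs_t X U z <= K <->
  0 <= K /\ forall M j, M \in U -> j \in M ->
    `|\sum_i lbar X M j i 0 * (tnth z i : R)| <= K.
Proof.
split=> [/bigmax_leP[K0 H]|[K0 H]].
  by split=> // M j /H /bigmax_leP[_]; exact.
by apply/bigmax_leP; split=> // M MU; apply/bigmax_leP; split=> // j; exact: H.
Qed.

Lemma measurable_bigmax d (T : measurableType d) (I : Type) (s : seq I)
    (P : pred I) (F : I -> T -> R) :
  (forall i, measurable_fun [set: T] (F i)) ->
  measurable_fun [set: T] (fun x => \big[Num.max/0]_(i <- s | P i) F i x).
Proof.
move=> mF; elim: s => [|i s IHs].
  rewrite (_ : (fun _ => _) = cst 0); first exact: measurable_cst.
  by apply/funext => x; rewrite big_nil.
rewrite (_ : (fun _ => _) = if P i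
    then F i \max (fun x => \big[Num.max/0]_(j <- s | P j) F j x)
    else (fun x => \big[Num.max/0]_(j <- s | P j) F j x)).
  by case: ifP => // _; exact: measurable_maxr.
by apply/funext => x; rewrite big_cons; case: ifP.
Qed.

Lemma measurable_max_abs_t d p (X : 'M[R]_(d, p)) U :
  measurable_fun [set: d.-tuple RR] (max_abs_t X U).
Proof.
apply: measurable_bigmax => M; apply: measurable_bigmax => j.
apply: measurableT_comp => //; apply: measurable_sum => i.
by apply: measurable_funM => //; exact: measurable_tnth.
Qed.

Lemma measurable_max_abs_le d p (X : 'M[R]_(d, p)) U (K : R) :
  measurable [set z : d.-tuple RR | max_abs_t X U z <= K].
Proof.
rewrite (_ : [set z | _] = max_abs_t X U @^-1` `]-oo, K]%classic).
  by apply: preimage_measurable; [exact: measurable_max_abs_t|exact: measurable_itv].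
by apply/seteqP; split=> z /=; rewrite in_itv.
Qed.

(** Continuity from below: the events [max_abs_t <= n] increase to the whole
    space. *)
Lemma confidence_set_nonempty d p (X : 'M[R]_(d, p)) U (alpha : R) :
  0 < alpha ->
  [set K : R | ((1 - alpha)%:E <=
     std_gaussian R d [set z | (max_abs_t X U z <= K)%R])%E] !=set0.
Proof.
move=> a0; pose F n := [set z : d.-tuple RR | max_abs_t X U z <= n%:R].
have UF : \bigcup_n F n = setT.
  apply/seteqP; split=> // z _; have z0 : 0 <= max_abs_t X U z.
    by have /max_abs_tP[] : max_abs_t X U z <= max_abs_t X U z by [].
  exists (Num.truncn (max_abs_t X U z)).+1 => //=.
  by apply: ltW; exact: truncnS_gt.
have mF n : measurable (F n) by exact: measurable_max_abs_le.
have ndF : nondecreasing_seq F.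
  by move=> m n mn; apply/subsetPset => z /le_trans; apply; rewrite ler_nat.
have a1 : ((1 - alpha)%:E < std_gaussian R d setT)%E.
  by rewrite probability_setT lte_fin ltrBlDr ltrDl.
have := @nondecreasing_cvg_mu _ _ _ (std_gaussian R d) F mF.
rewrite UF => /(_ measurableT ndF _ (open_ereal_gt' a1)) [n _ Fn].
by exists n%:R; apply: ltW; exact: (Fn n (leqnn n)).
Qed.

(** The constant of the identity design, written without reference to designs
    and universes. *)
Definition box_const d (alpha : R) : R :=
  inf [set K : R | ((1 - alpha)%:E <= std_gaussian R d (coord_box d K))%E].

Lemma box_levels_ge0 d (alpha : R) : alpha < 1 ->
  lbound [set K : R | ((1 - alpha)%:E <= std_gaussian R d (coord_box d K))%E] 0.
Proof.
move=> a1 K /=; apply: contraTle => K0; rewrite -ltNge.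
rewrite (_ : coord_box d K = set0) ?measure0 ?lte_fin ?subr_gt0//.
by apply/seteqP; split=> z //= -[]; rewrite leNgt K0.
Qed.

Lemma box_const_le d (alpha K : R) : alpha < 1 ->
  ((1 - alpha)%:E <= std_gaussian R d (coord_box d K))%E ->
  box_const d alpha <= K.
Proof.
by move=> a1 HK; apply: ge_inf => //; exists 0; exact: box_levels_ge0.
Qed.

Lemma max_abs_t_law_orthogonal d (X : 'M[R]_d) U (K : R) :
  orthogonal_design X -> model_universe X U ->
  std_gaussian R d [set z | max_abs_t X U z <= K] =
  std_gaussian R d (coord_box d K).
Proof.
move=> Xo /and3P[_ _ /eqP cU].
have [_ <-] := std_gaussian_orthonormal_box K (orthogonal_orthonormal Xo).
congr (std_gaussian R d _); apply/seteqP; split=> z /=.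
  move=> /max_abs_tP[K0 H]; split=> // k.
  have /bigcupP[M MU kM] : k \in finset.cover U by rewrite cU inE.
  by have := H M k MU kM; rewrite orthogonal_lbar.
move=> [K0 H]; apply/max_abs_tP; split=> // M j _ _.
by rewrite orthogonal_lbar//; exact: H.
Qed.

Lemma posi_const_orthogonal d (X : 'M[R]_d) U (alpha : R) :
  orthogonal_design X -> model_universe X U ->
  posi_const X U alpha = box_const d alpha.
Proof.
move=> Xo mU; rewrite /posi_const /box_const; congr inf.
by apply/seteqP; split=> K /=; rewrite max_abs_t_law_orthogonal.
Qed.

(** The nested submodels contribute an orthonormal basis to the maximum, so
    each confidence level reached by [max_abs_t] at [K] is reached by a box of
    half-width [K]. *)
Lemma posi_const_ge_box d p (X : 'M[R]_(d, p)) U (alpha : R) :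
  0 < alpha -> alpha < 1 -> admissible X U ->
  box_const d alpha <= posi_const X U alpha.
Proof.
move=> a0 a1 [_ /and3P[_ /fintype.subsetP UX _] [j jinj jU]].
apply: lb_le_inf; first exact: confidence_set_nonempty.
move=> K /= HK; apply: box_const_le => //; apply: le_trans HK _.
have [mq <-] := std_gaussian_orthonormal_box K
  (nested_lbar_orthonormal jinj (fun k => UX _ (jU k))).
apply: le_measure; rewrite ?inE//; first exact: measurable_max_abs_le.
move=> z /= /max_abs_tP[K0 H]; split=> // k; apply: H => //.
by apply/imsetP; exists k; rewrite ?inE.
Qed.

Lemma K_orthE d (alpha : R) : (0 < d)%N -> K_orth d alpha = box_const d alpha.
Proof.
move=> d0; have Io := identity_orthogonal R d.
have [_ mU _] := orthogonal_admissible d0 Io.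
exact: posi_const_orthogonal.
Qed.

Lemma K_orth_le d (alpha K : R) : (0 < d)%N -> alpha < 1 -> 0 <= K ->
  1 - alpha <= (1 - normal_tail K) ^+ d -> K_orth d alpha <= K.
Proof.
move=> d0 a1 K0 HK; rewrite K_orthE//; apply: box_const_le => //.
by rewrite std_gaussian_coord_box// lee_fin.
Qed.

Lemma K_orth_ge d (alpha K : R) : (0 < d)%N -> 0 < alpha -> 0 <= K ->
  (1 - normal_tail K) ^+ d < 1 - alpha -> K <= K_orth d alpha.
Proof.
move=> d0 a0 K0 HK.
have Io := identity_orthogonal R d.
have [_ mU _] := orthogonal_admissible d0 Io.
apply: lb_le_inf; first exact: confidence_set_nonempty.
move=> L /=; rewrite max_abs_t_law_orthogonal// => HL; rewrite leNgt; apply/negP => LK.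
have : ((1 - alpha)%:E <= std_gaussian R d (coord_box d K))%E.
  apply: le_trans HL _; apply: le_measure; rewrite ?inE; try exact: measurable_coord_box.
  by move=> z /= [L0 zL]; split=> // i; rewrite (le_trans (zL i))// ltW.
by rewrite std_gaussian_coord_box// lee_fin leNgt HK.
Qed.

Lemma bernoulli_inequality (x : R) d : 0 <= x <= 1 -> 1 - d%:R * x <= (1 - x) ^+ d.
Proof.
move=> /andP[x0 x1]; elim: d => [|d IHd]; first by rewrite mul0r subr0 expr0.
rewrite exprS; apply: le_trans (_ : (1 - x) * (1 - d%:R * x) <= _); last first.
  by rewrite ler_wpM2l// subr_ge0.
rewrite -natr1 -subr_ge0.
have -> : (1 - x) * (1 - d%:R * x) - (1 - (d%:R + 1) * x) = d%:R * x ^+ 2 by ring.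
by rewrite mulr_ge0// sqr_ge0.
Qed.

Definition sqrt_2ln d : R := Num.sqrt (2 * ln d%:R).

Lemma expR_sqrt_2ln d : (0 < d)%N -> expR (sqrt_2ln d ^+ 2 / 2) = d%:R.
Proof.
move=> d0; rewrite sqr_sqrtr; last by rewrite mulr_ge0// ln_ge0// ler1n.
by rewrite [2 * _]mulrC mulfK// lnK// posrE ltr0n.
Qed.

(** [s] is the standard deviation for which the tilting exponent [(1 - s ^ -2)
    (1 + e) ^ 2] equals [1 + e]; a factor [exp (- e t ^ 2 / 2)] is left after
    multiplication by [d]. *)
Lemma K_orth_upper d (alpha e : R) : (0 < d)%N -> 0 < alpha -> alpha < 1 -> 0 < e ->
  Num.sqrt ((1 + e) / e) / alpha <= e * sqrt_2ln d ^+ 2 / 2 ->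
  K_orth d alpha <= (1 + e) * sqrt_2ln d.
Proof.
move=> d0 a0 a1 e0; set s := Num.sqrt _; set t := sqrt_2ln d => st.
have t0 : 0 <= t by exact: sqrtr_ge0.
have e1 : 0 < 1 + e by rewrite addr_gt0.
have s2 : s ^+ 2 = (1 + e) / e by rewrite sqr_sqrtr// divr_ge0// ltW.
have s1 : 1 <= s.
  have <- : Num.sqrt (1 : R) = 1 by exact: sqrtr1.
  by rewrite ler_wsqrtr// ler_pdivlMr// mul1r lerDr.
have K0 : 0 <= (1 + e) * t by rewrite mulr_ge0// ltW.
apply: K_orth_le => //; apply: le_trans (bernoulli_inequality _ _); last first.
  by rewrite normal_tail_ge0 normal_tail_le1.
rewrite lerD2l lerN2.
apply: le_trans (ler_wpM2l (ler0n _ d) (normal_tail_ub s1 K0)) _.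
rewrite -(expR_sqrt_2ln d0) -/t mulrCA -expRD s2.
have -> : t ^+ 2 / 2 + - ((1 - ((1 + e) / e)^-1) * ((1 + e) * t) ^+ 2 / 2)
   = - (e * t ^+ 2 / 2).
  by field; rewrite !gt_eqF.
rewrite expRN ler_pdivrMr ?expR_gt0//.
have := expR_ge1Dx (e * t ^+ 2 / 2).
move: (e * t ^+ 2 / 2) st => y; rewrite ler_pdivrMr// => sy y1.
apply: (le_trans sy); rewrite mulrC ler_pM2l//; apply: le_trans y1.
by rewrite lerDr.
Qed.

(** With [t = sqrt_2ln d], the exponent [t ^ 2 / 2 - ((1 - e) t + 1) ^ 2 / 2]
    of [d] times the tail factors as [(e t - 1) ((2 - e) t + 1) / 2], hence
    grows at least like [(e t - 1) / 2]. *)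
Lemma K_orth_lower d (alpha e : R) : (0 < d)%N -> 0 < alpha -> alpha < 1 ->
  0 < e -> e < 1 -> 1 <= e * sqrt_2ln d ->
  - ln (1 - alpha) < normal_peak 1 * ((e * sqrt_2ln d - 1) / 2) ->
  (1 - e) * sqrt_2ln d <= K_orth d alpha.
Proof.
move=> d0 a0 a1 e0 e1; set t := sqrt_2ln d => et1 H.
have t0 : 0 <= t by exact: sqrtr_ge0.
have K0 : 0 <= (1 - e) * t by rewrite mulr_ge0// subr_ge0 ltW.
have c0 : 0 < normal_peak (1 : R) by exact: normal_peak_gt0.
apply: K_orth_ge => //.
have : (1 - normal_tail ((1 - e) * t)) ^+ d <=
    expR (- (d%:R * normal_tail ((1 - e) * t))).
  rewrite -mulrN expRM_natl.
  apply: lerXn2r; rewrite ?nnegrE ?expR_ge0 ?subr_ge0 ?normal_tail_le1//.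
  exact: expR_ge1Dx.
move=> /le_lt_trans; apply.
rewrite -[ltRHS]lnK ?posrE ?subr_gt0// ltr_expR ltrNl.
apply: (lt_le_trans H).
apply: le_trans (_ : d%:R *
    (normal_peak 1 * expR (- ((1 - e) * t + 1) ^+ 2 / 2)) <= _); last first.
  by apply: ler_wpM2l => //; exact: normal_tail_lb.
rewrite -(expR_sqrt_2ln d0) -/t [leRHS]mulrCA -expRD ler_pM2l//.
apply: le_trans (expR_ge1Dx _).
set u := t ^+ 2 / 2 + _.
have -> : u = (e * t - 1) * ((2 - e) * t + 1) / 2 by rewrite /u; field.
apply: (@le_trans _ _ ((e * t - 1) * ((2 - e) * t + 1) / 2)); last by rewrite lerDr.
rewrite ler_pM2r// ler_peMr ?subr_ge0// lerDr mulr_ge0// subr_ge0.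
by rewrite (le_trans (ltW e1))// ler1n.
Qed.

Lemma near_sqrt_2ln_ge (T : R) : \forall d \near \oo, T <= sqrt_2ln d.
Proof.
near=> d.
have dT : expR (T ^+ 2 / 2) <= d%:R by near: d; exact: nbhs_infty_ger.
have d0 : 0 < d%:R :> R by rewrite (lt_le_trans _ dT)// expR_gt0.
rewrite (le_trans (ler_norm T))// -sqrtr_sqr ler_wsqrtr//.
rewrite -ler_pdivrMl// mulrC -ler_expR lnK ?posrE//.
Unshelve. all: by end_near. Qed.

(** All requirements of the two previous bounds are lower bounds on [sqrt_2ln
    d]. *)
Lemma cvg_K_orth_ratio (alpha : R) : 0 < alpha -> alpha < 1 ->
  (fun d => K_orth d alpha / sqrt_2ln d - 1) @ \oo --> (0 : R).
Proof.
move=> a0 a1; apply/cvgrPdist_le => e' e'0.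
(* The lower bound requires [e < 1]. *)
pose e := Num.min e' (1 / 2).
have e0 : 0 < e by rewrite lt_min e'0 divr_gt0.
have e1 : e < 1 by rewrite gt_min; apply/orP; right; lra.
have ee : e <= e' by rewrite ge_min lexx.
have c0 : 0 < normal_peak (1 : R) by exact: normal_peak_gt0.
near=> d.
have d0 : (0 < d)%N by near: d; exists 1%N.
have T1 : 1 <= sqrt_2ln d by near: d; exact: near_sqrt_2ln_ge.
have T2 : e^-1 <= sqrt_2ln d by near: d; exact: near_sqrt_2ln_ge.
have T3 : 2 / e * (Num.sqrt ((1 + e) / e) / alpha) <= sqrt_2ln d.
  by near: d; exact: near_sqrt_2ln_ge.
have T4 : (1 + (1 - ln (1 - alpha)) / normal_peak 1 * 2) / e <= sqrt_2ln d.
  by near: d; exact: near_sqrt_2ln_ge.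
have t0 : 0 < sqrt_2ln d by exact: lt_le_trans T1.
have up : K_orth d alpha <= (1 + e) * sqrt_2ln d.
  apply: K_orth_upper => //.
  have H : Num.sqrt ((1 + e) / e) / alpha <= e / 2 * sqrt_2ln d.
    by rewrite -ler_pdivrMl ?divr_gt0// invf_div.
  have -> : e * sqrt_2ln d ^+ 2 / 2 = e / 2 * sqrt_2ln d * sqrt_2ln d by ring.
  apply: (le_trans H); rewrite ler_peMr// mulr_ge0 ?divr_ge0// ltW//.
have lo : (1 - e) * sqrt_2ln d <= K_orth d alpha.
  apply: K_orth_lower => //.
    by rewrite mulrC -ler_pdivrMr// mul1r.
  have : 1 + (1 - ln (1 - alpha)) / normal_peak 1 * 2 <= e * sqrt_2ln d.
    by rewrite [leRHS]mulrC -ler_pdivrMr.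
  rewrite -lerBrDl -ler_pdivlMr// ler_pdivrMr// mulrC.
  by apply: lt_le_trans; rewrite ltrDr.
apply: le_trans ee; rewrite sub0r normrN ler_norml; apply/andP; split.
  by rewrite lerBrDr addrC ler_pdivlMr.
by rewrite lerBlDr addrC ler_pdivrMr.
Unshelve. all: by end_near. Qed.

End Constants.

Theorem proposition5p5 (R : realType) (alpha : R) (alpha_gt0 : 0 < alpha)
    (alpha_lt1 : alpha < 1) :
  (forall d : nat, (0 < d)%N ->
    [/\ forall (X : 'M[R]_d) (U : {set {set 'I_d}}),
          orthogonal_design X -> model_universe X U ->
          posi_const X U alpha = K_orth d alpha,
        forall X : 'M[R]_d, orthogonal_design X ->
          exists U : {set {set 'I_d}}, admissible X U &
        ereal_inf (EFin @` posi_values d alpha) = (K_orth d alpha)%:E]) /\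
  (exists2 eps : nat -> R, eps @ \oo --> (0 : R) &
    \forall d \near \oo,
      K_orth d alpha = Num.sqrt (2 * ln d%:R) * (1 + eps d)).
Proof.
split=> [d d0|]; last first.
  exists (fun d => K_orth d alpha / sqrt_2ln R d - 1); first exact: cvg_K_orth_ratio.
  near=> d; rewrite addrC subrK -/(sqrt_2ln R d) mulrC divfK// gt_eqF//.
  by apply: lt_le_trans (_ : 1 <= _) => //; near: d; exact: near_sqrt_2ln_ge.
split.
- by move=> X U Xo mU; rewrite K_orthE//; exact: posi_const_orthogonal.
- by move=> X Xo; exists (M_all X); exact: orthogonal_admissible.
- apply/eqP; rewrite eq_le; apply/andP; split.
    apply: ereal_inf_lbound; exists (K_orth d alpha) => //.
    exists d, (1%:M : 'M[R]_d), (M_all (1%:M : 'M[R]_d)); split=> //.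
    by apply: orthogonal_admissible => //; exact: identity_orthogonal.
  apply: le_ereal_inf_tmp => _ [_ [p [X [U [XU ->]]]] <-].
  by rewrite lee_fin K_orthE// posi_const_ge_box.
Unshelve. all: by end_near. Qed.
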